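(* Let $G$ be a finite graph possibly with loops (but no parallel edges). (1) If $\varphi$ and $\varphi'$ are sequences of operations, each operation being either a local complementation or a pivot, both applicable to $G$, and $\sup(\varphi)=\sup(\varphi')$, then $G\varphi=G\varphi'$. (2) For $S\subseteq V(G)$, $\det(G|_S)=1$ if and only if there exists a sequence $\varphi$ of local complementations and pivots with $\sup(\varphi)=S$ that is applicable to $G$; moreover such a $\varphi$ can be chosen to be reduced.
   Context: The adjacency matrix of a graph with loops is the symmetric $(0,1)$-matrix with $a_{x,y}=1$ iff $\{x,y\}$ is an edge and $a_{x,x}=1$ iff $x$ has a loop; $\det H$ is its determinant over $GF(2)$ (empty determinant $=1$); $G|_S$ is the induced subgraph. Local complementation $*u$ is defined only when $u$ has a loop: $G*u$ toggles the edge $\{v,w\}$ for all distinct $v,w\in N_G(u)\setminus\{u\}$ and toggles the loop at every $v\in N_G(u)\setminus\{u\}$. Pivot $[uv]$ is defined only when $\{u,v\}$ is an edge, $u\neq v$, and neither $u$ nor $v$ has a loop: with $N'(x)=N(x)\cup\{x\}$ (neighbourhoods among distinct vertices), $V_1=N'(u)\setminus N'(v)$, $V_2=N'(v)\setminus N'(u)$, $V_3=N'(u)\cap N'(v)$, $G[uv]$ toggles every pair $\{x,y\}$ with $x\in V_i$, $y\in V_j$, $i\neq j$, and does not change any loop. A sequence of such operations is applicable to $G$ if each operation is defined on the graph obtained by applying the preceding ones; $G\varphi$ is the result. The support $\sup(\varphi)$ is the symmetric difference of the sets $\{u\}$ over all local complementations $*u$ and $\{u,v\}$ over all pivots $[uv]$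 in $\varphi$, i.e. the set of vertices occurring an odd number of times. A sequence is reduced if no vertex occurs more than once in it. *)

(* Defs.v *)
From HB Require Import structures.
From mathcomp Require Import all_boot all_order all_algebra.
Set Implicit Arguments.
Unset Strict Implicit.
Unset Printing Implicit Defensive.
Import GRing.Theory.

(* A loop at x is the diagonal value [(x, x)]. The relation is stored as a     *)
(* finite function and its symmetry as a boolean, so that Leibniz equality of  *)
(* graphs is equality of their adjacency relations (lemma lgraphP).            *)
Record lgraph (V : finType) := LGraph {
  lgraph_val : {ffun V * V -> bool};
  lgraph_valP : [forall x, forall y, lgraph_val (x, y) == lgraph_val (y, x)] }.

HB.instance Definition _ (V : finType) := [isSub for @lgraph_val V].
HB.instance Definition _ (V : finType) := [Equality of lgraph V by <:].

Section Graphs.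
Variable V : finType.
Implicit Types G : lgraph V.

Definition adj G : rel V := fun x y => lgraph_val G (x, y).

Definition looped G (x : V) : bool := adj G x x.

Lemma adj_sym G : symmetric (adj G).
Proof. by move=> x y; have /forallP/(_ x)/forallP/(_ y)/eqP := lgraph_valP G. Qed.

Lemma lgraphP G H : (forall x y, adj G x y = adj H x y) <-> G = H.
Proof.
split=> [eqGH | -> //]; apply/val_inj/ffunP=> -[x y]; exact: eqGH.
Qed.

Lemma mk_lgraph_proof (e : rel V) (e_sym : symmetric e) :
  [forall x, forall y, [ffun p : V * V => e p.1 p.2] (x, y)
                       == [ffun p : V * V => e p.1 p.2] (y, x)].
Proof. by apply/forallP=> x; apply/forallP=> y; rewrite !ffunE /= e_sym. Qed.

Definition mk_lgraph (e : rel V) (e_sym : symmetric e) : lgraph V :=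
  LGraph (mk_lgraph_proof e_sym).

Lemma adj_mk_lgraph (e : rel V) (e_sym : symmetric e) x y :
  adj (mk_lgraph e_sym) x y = e x y.
Proof. by rewrite /adj /= ffunE. Qed.

Definition adjmx G : 'M['F_2]_#|V| :=
  \matrix_(i, j) ((adj G (enum_val i) (enum_val j))%:R)%R.

Definition gdet G : 'F_2 := (\det (adjmx G))%R.

Definition nbh G (u : V) : {set V} := [set x | (x != u) && adj G u x].

Definition cnbh G (u : V) : {set V} := u |: nbh G u.

Definition toggle G (r : rel V) : rel V := fun x y => adj G x y (+) r x y.

Lemma toggle_sym G (r : rel V) : symmetric r -> symmetric (toggle G r).
Proof. by move=> r_sym x y; rewrite /toggle adj_sym r_sym. Qed.

(* The diagonal pairs of this relation are the loops toggled by [*u].          *)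
Definition lc_rel G (u : V) : rel V :=
  fun x y => (x \in nbh G u) && (y \in nbh G u).

Lemma lc_rel_sym G u : symmetric (lc_rel G u).
Proof. by move=> x y; rewrite /lc_rel andbC. Qed.

Definition local_compl G (u : V) : lgraph V :=
  mk_lgraph (toggle_sym G (lc_rel_sym G u)).

Definition pivot_class G (u v : V) (i : 'I_3) : {set V} :=
  match val i with
  | 0 => cnbh G u :\: cnbh G v
  | 1 => cnbh G v :\: cnbh G u
  | _ => cnbh G u :&: cnbh G v
  end.

(* The three classes are disjoint, so no diagonal pair is related.             *)
Definition pivot_rel G (u v : V) : rel V := fun x y =>
  [exists i : 'I_3, exists j : 'I_3,
    [&& i != j, x \in pivot_class G u v i & y \in pivot_class G u v j]].

Lemma pivot_rel_sym G u v : symmetric (pivot_rel G u v).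
Proof.
suff sub x y : pivot_rel G u v x y -> pivot_rel G u v y x.
  by move=> x y; apply/idP/idP; apply: sub.
case/existsP=> i /existsP[j /and3P[neq_ij xi yj]].
by apply/existsP; exists j; apply/existsP; exists i; rewrite eq_sym neq_ij yj xi.
Qed.

Definition pivot G (u v : V) : lgraph V :=
  mk_lgraph (toggle_sym G (pivot_rel_sym G u v)).

Inductive operation :=
  | LocalCompl of V
  | Pivot of V & V.

(* The value is meaningful only where [op_defined] holds.                      *)
Definition op_apply G (o : operation) : lgraph V :=
  match o with
  | LocalCompl u => local_compl G u
  | Pivot u v => pivot G u v
  end.

Definition op_defined G (o : operation) : bool :=
  match o with
  | LocalCompl u => looped G u
  | Pivot u v => [&& u != v, adj G u v, ~~ looped G u & ~~ looped G v]
  end.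

Definition seq_apply G (phi : seq operation) : lgraph V :=
  foldl op_apply G phi.

Fixpoint applicable G (phi : seq operation) : bool :=
  if phi is o :: phi' then op_defined G o && applicable (op_apply G o) phi'
  else true.

Definition op_vertices (o : operation) : seq V :=
  match o with
  | LocalCompl u => [:: u]
  | Pivot u v => [:: u; v]
  end.

Definition symdiff (A B : {set V}) : {set V} := (A :\: B) :|: (B :\: A).

Definition op_support (phi : seq operation) : {set V} :=
  \big[symdiff/set0]_(o <- phi) [set:: op_vertices o].

Definition reduced (phi : seq operation) : bool :=
  uniq (flatten (map op_vertices phi)).

End Graphs.

Arguments LocalCompl {V}.
Arguments Pivot {V}.

Lemma induced_sym (V : finType) (G : lgraph V) (S : {set V}) :
  symmetric (fun x y : {x : V | x \in S} => adj G (val x) (val y)).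
Proof. by move=> x y; apply: adj_sym. Qed.

Definition induced (V : finType) (G : lgraph V) (S : {set V}) :
  lgraph {x : V | x \in S} := mk_lgraph (@induced_sym V G S).

(* Main.v *)
Require Import Defs.
From mathcomp Require Import all_boot all_order all_algebra.

(** Attach to [G], with adjacency matrix [A], the subspace
    [L(G) = {(w, A w)}] of pairs of vectors over GF(2). A local complementation
    or a pivot turns [L(G)] into its image under the exchange of the two
    coordinates at each vertex of the operation, so that [L(G phi)] is [L(G)]
    with the coordinates exchanged exactly on [sup(phi)]; as [L(G)] determines
    [G], this gives (1). The image of [L(G)] under the exchange on [S] is again
    the graph of a linear map iff it contains no [(0, z)] with [z <> 0], i.e. iff
    no nonzero [w] supported in [S] satisfies [(A w)|_S = 0], i.e. iff [G|_S] is
    nonsingular. For the converse in (2), a nonsingular nonempty [G|_S] has a loop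
    or an edge, whose operation reduces [S] and preserves this criterion. *)

Set Implicit Arguments.
Unset Strict Implicit.
Unset Printing Implicit Defensive.
Import GRing.Theory.

(** * Vectors over GF(2), the subspace of a graph, and exchange of coordinates *)

Section Lagrangian.
Variable V : finType.
Implicit Types (G : lgraph V) (S T : {set V}) (w z : V -> bool).

(** Vectors over GF(2) are boolean functions, with [addb] as sum and [andb] as product, so that
    coordinatewise identities reduce to case analysis on booleans. *)
Definition apply_adj G w (i : V) : bool :=
  \big[addb/false]_j (adj G i j && w j).

Definition lagr G w z : Prop := z =1 apply_adj G w.

(** This is only the first component of the exchanged pair, which is [(swap S w z, swap S z w)]. *)
Definition swap S w z : V -> bool := fun i => if i \in S then z i else w i.

Lemma in_symdiff S T i : (i \in symdiff S T) = (i \in S) (+) (i \in T).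
Proof. by rewrite !inE; do 2!case: (i \in _). Qed.

Lemma eq_apply_adj G w w' : w =1 w' -> apply_adj G w =1 apply_adj G w'.
Proof. by move=> eq_w i; apply: eq_bigr => j _; rewrite eq_w. Qed.

Lemma eq_lagr G w w' z z' : w =1 w' -> z =1 z' -> lagr G w z -> lagr G w' z'.
Proof. by move=> eq_w eq_z Lwz i; rewrite -eq_z Lwz (eq_apply_adj G eq_w). Qed.

Lemma swap_swap S T w z :
  swap T (swap S w z) (swap S z w) =1 swap (symdiff S T) w z.
Proof. by move=> i; rewrite /swap in_symdiff; do 2!case: (i \in _). Qed.

Lemma swapK S w z : swap S (swap S w z) (swap S z w) =1 w.
Proof. by move=> i; rewrite /swap; case: (i \in _). Qed.

Lemma swap0 w z : swap set0 w z =1 w.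
Proof. by move=> i; rewrite /swap inE. Qed.

Lemma apply_adj_pred1 G x i : apply_adj G (pred1 x) i = adj G i x.
Proof.
rewrite /apply_adj (bigD1 x) //= eqxx andbT big1 ?addbF // => j /negPf ->.
by rewrite andbF.
Qed.

(** * Effect of a single operation on the subspace *)

Lemma adj_local_compl G u x y : adj (local_compl G u) x y =
  adj G x y (+) [&& x != u, y != u, adj G x u & adj G u y].
Proof.
rewrite adj_mk_lgraph /toggle /lc_rel !inE (adj_sym G x u).
by case: (x == u); case: (y == u); rewrite ?andbF.
Qed.

Lemma in_cnbh G u x : (x \in cnbh G u) = (x == u) || adj G u x.
Proof. by rewrite !inE; case: eqP. Qed.

(** Encode a vertex by its memberships in the closed neighbourhoods of [u] and [v]. The three
    classes are the nonzero vectors of GF(2)^2, and two of these differ iff they are independent,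
    i.e. iff their 2 by 2 determinant is 1. *)
Lemma pivot_relE G u v x y : pivot_rel G u v x y =
  ((x \in cnbh G u) && (y \in cnbh G v)) (+)
  ((x \in cnbh G v) && (y \in cnbh G u)).
Proof.
have exI3 (P : pred 'I_3) : [exists i, P i] =
    [|| P (inord 0), P (inord 1) | P (inord 2)].
  apply/existsP/or3P=> [[i Pi]|[Pi|Pi|Pi]]; try by eexists; exact: Pi.
  have: P (inord i) by rewrite inord_val.
  by case: i {Pi} => -[|[|[]]] //= _; [apply: Or31|apply: Or32|apply: Or33].
rewrite /pivot_rel exI3 !exI3 /pivot_class /= -!val_eqE /= !inordK //=.
rewrite !in_setD !in_setI.
by do 4!case: (_ \in cnbh _ _).
Qed.

(** Because of the loop, row [u] reads [z u = w u + s u], with [s] the contribution of the columns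
    other than [u]. Solving it for [w u] and substituting into row [i] adds [adj G i u && s u], the
    rank-one change made by the toggling. *)
Lemma lagr_local_compl G u w z : looped G u ->
  lagr G w z <-> lagr (local_compl G u) (swap [set u] w z) (swap [set u] z w).
Proof.
rewrite /looped => lu.
pose s i := \big[addb/false]_(j | j != u) (adj G i j && w j).
have E1 i : apply_adj G w i = (adj G i u && w u) (+) s i.
  by rewrite /apply_adj (bigD1 u).
have E2 i : apply_adj (local_compl G u) (swap [set u] w z) i =
    (adj G i u && z u) (+) s i (+) [&& i != u, adj G i u & s u].
  rewrite /apply_adj (bigD1 u) //= adj_local_compl eqxx /= andbF addbF.
  rewrite /swap set11 -addbA; congr (_ (+) _).
  rewrite andbA big_distrr -big_split /=; apply: eq_bigr => j ju.
  rewrite adj_local_compl inE ju (negPf ju) /=.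
  by case: (w j); rewrite ?andbF ?andbT //= -andbA.
split=> L i.
  rewrite E2 /swap inE; have:= L i; have:= L u; rewrite !E1 lu /= => Lu.
  case: eqP => [->|_] Li /=.
    by rewrite lu Lu /=; case: (w u); case: (s u).
  by rewrite Li Lu; do 2!case: (s _); case: (w u); case: (adj _ _ _).
have:= L i; have:= L u; rewrite !E2 E1 /swap set11 inE eqxx lu /= => Lu.
case: eqP => [->|_] Li /=.
  by move: Lu; rewrite lu; case: (w u); case: (s u); case: (z u).
by rewrite Li Lu; do 2!case: (s _); case: (z u); case: (adj _ _ _).
Qed.

(** Rows [u] and [v] read [z u = w v + s u] and [z v = w u + s v], and are solved for [w v] and
    [w u]. In any other row [i], the substitution exchanges the entries in columns [u] and [v] and
    adds [adj G i u && s v] and [adj G i v && s u], as the pivot does. *)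
Lemma lagr_pivot G u v w z : op_defined G (Pivot u v) ->
  lagr G w z <->
  lagr (pivot G u v) (swap [set u; v] w z) (swap [set u; v] z w).
Proof.
case/and4P=> uv auv; rewrite /looped => /negPf lu /negPf lv.
have avu : adj G v u by rewrite adj_sym.
have vu : (v == u) = false by rewrite eq_sym (negPf uv).
have uvE := (vu, negPf uv, lu, lv, auv, avu).
pose s i := \big[addb/false]_(j | (j != u) && (j != v)) (adj G i j && w j).
have E1 i : apply_adj G w i = (adj G i u && w u) (+) (adj G i v && w v) (+) s i.
  by rewrite /apply_adj (bigD1 u) //= (bigD1 v) ?vu //= addbA.
have adjP x y : adj (pivot G u v) x y = adj G x y (+)
    (((x == u) || adj G x u) && ((y == v) || adj G v y)) (+)
    (((x == v) || adj G x v) && ((y == u) || adj G u y)).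
  rewrite adj_mk_lgraph /toggle pivot_relE !in_cnbh addbA.
  by rewrite (adj_sym G x u) (adj_sym G x v).
have E2 i : apply_adj (pivot G u v) (swap [set u; v] w z) i =
    (adj (pivot G u v) i u && z u) (+) (adj (pivot G u v) i v && z v) (+)
    (s i (+) (((i == u) || adj G i u) && s v)
         (+) (((i == v) || adj G i v) && s u)).
  rewrite /apply_adj (bigD1 u) //= (bigD1 v) ?vu //= addbA.
  rewrite {1 2}/swap !inE !eqxx orbT /=; congr (_ (+) _).
  rewrite !big_distrr -!big_split /=; apply: eq_bigr => j /andP[ju jv].
  rewrite adjP /swap !inE (negPf ju) (negPf jv) /=.
  by case: (w j); rewrite ?andbF ?andbT.
split=> L i.
  have:= L i; have:= L u; have:= L v.
  rewrite E2 !E1 !adjP !eqxx !uvE /swap !inE /= => Lv Lu.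
  case: (eqVneq i u) => [->|iu] Li /=.
    rewrite ?uvE Lu Lv /=.
    by case: (w u); case: (w v); case: (s u); case: (s v).
  case: (eqVneq i v) => [->|iv] /=.
    rewrite ?uvE Lu Lv /=.
    by case: (w u); case: (w v); case: (s u); case: (s v).
  rewrite Li Lu Lv; case: (s i); case: (w u); case: (w v); case: (s u);
    by case: (s v); case: (adj G i u); case: (adj G i v).
have:= L i; have:= L u; have:= L v.
rewrite !E2 !E1 !adjP !eqxx !uvE /swap !inE !eqxx ?uvE /= => Lv Lu.
case: (eqVneq i u) => [->|iu] Li /=.
  rewrite ?uvE; move: Lu Lv.
  by case: (w u); case: (w v); case: (s u); case: (s v); case: (z u); case: (z v).
case: (eqVneq i v) Li => [->|iv] Li /=.
  rewrite ?uvE; move: Lu Lv.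
  by case: (w u); case: (w v); case: (s u); case: (s v); case: (z u); case: (z v).
move: Li Lu Lv => /= -> -> ->; case: (s i); case: (z u); case: (z v); case: (s u);
  by case: (s v); case: (adj G i u); case: (adj G i v).
Qed.

(** * Sequences of operations, and uniqueness of the result *)

Lemma lagr_op G o w z : op_defined G o ->
  lagr G w z <-> lagr (op_apply G o) (swap [set:: op_vertices o] w z)
                                     (swap [set:: op_vertices o] z w).
Proof.
case: o => [u|u v] /=.
  suff ->: [set:: [:: u]] = [set u] by apply: lagr_local_compl.
  by apply/setP=> x; rewrite !inE.
suff ->: [set:: [:: u; v]] = [set u; v] by apply: lagr_pivot.
by apply/setP=> x; rewrite !inE.
Qed.

Lemma op_support_cons o (phi : seq (operation V)) :
  op_support (o :: phi) = symdiff [set:: op_vertices o] (op_support phi).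
Proof. exact: big_cons. Qed.

Lemma lagr_seq G phi w z : applicable G phi ->
  lagr G w z <-> lagr (seq_apply G phi) (swap (op_support phi) w z)
                                        (swap (op_support phi) z w).
Proof.
elim: phi G w z => [|o phi IH] G w z /=.
  rewrite /op_support big_nil => _.
  by split; apply: eq_lagr => i; rewrite swap0.
case/andP=> Go /IH {}IH.
apply: iff_trans (lagr_op w z Go) _; apply: iff_trans (IH _ _) _.
rewrite op_support_cons.
by split; apply: eq_lagr => i; rewrite swap_swap.
Qed.

Lemma seq_apply_support G phi phi' : applicable G phi -> applicable G phi' ->
  op_support phi = op_support phi' -> seq_apply G phi = seq_apply G phi'.
Proof.
move=> Gphi Gphi' eq_sup; set S := op_support phi in eq_sup.
apply/lgraphP=> x y.
(* [z] is column [y] of the result of [phi]. The pair is pulled back to [G] along [phi] and pushed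
   forward along [phi']; equal supports return the same pair, so [z] is also column [y] of the other
   result. *)
set w : V -> bool := pred1 y; set z := apply_adj (seq_apply G phi) w.
have : lagr G (swap S w z) (swap S z w).
  apply/(lagr_seq _ _ Gphi).
  by apply: (@eq_lagr _ w _ z) => // i; rewrite -/S swapK.
move/(lagr_seq _ _ Gphi'); rewrite -eq_sup.
move/(eq_lagr (swapK _ _ _) (swapK _ _ _))/(_ x).
by rewrite /z !apply_adj_pred1.
Qed.

(** * Nonsingularity in terms of the subspace, and reduced sequences *)

Definition nonsing G S : Prop :=
  forall w z, lagr G w z -> swap S w z =1 xpred0 -> swap S z w =1 xpred0.

Lemma nonsing_set0 G : nonsing G set0.
Proof.
move=> w z Lwz w0 i; rewrite swap0 Lwz.
by apply: big1 => j _; move: (w0 j); rewrite swap0 => ->; rewrite andbF.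
Qed.

(** The exchanged subspace is that of the resulting graph, whose linear map sends 0 to 0. *)
Lemma nonsing_applicable G phi : applicable G phi -> nonsing G (op_support phi).
Proof.
move=> Gphi w z /(lagr_seq _ _ Gphi) L w0 i.
rewrite -[LHS](swap0 _ (swap (op_support phi) w z)).
by apply: (nonsing_set0 L) => j; rewrite swap0.
Qed.

Lemma nonsing_op G o S : op_defined G o ->
  nonsing G (symdiff [set:: op_vertices o] S) -> nonsing (op_apply G o) S.
Proof.
set T := [set:: _] => Go NS w z Lwz w0.
have L : lagr G (swap T w z) (swap T z w).
  by apply/(lagr_op _ _ Go)/(eq_lagr _ _ Lwz) => i; rewrite swapK.
have E w' z' : swap (symdiff T S) (swap T w' z') (swap T z' w') =1 swap S w' z'.
  by move=> i; rewrite /swap in_symdiff; do 2!case: (i \in _).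
by move=> i; rewrite -E; apply: (NS _ _ L) => j; rewrite E w0.
Qed.

Lemma nonsing_ex_op G S : nonsing G S -> S != set0 ->
  exists o, [/\ op_defined G o, uniq (op_vertices o)
              & [set:: op_vertices o] \subset S].
Proof.
move=> NS /set0Pn[x xS].
have [/existsP[u /andP[uS lu]]|/existsPn noloop] :=
    boolP [exists u, (u \in S) && looped G u].
  exists (LocalCompl u); split=> //=.
  by apply/subsetP=> y; rewrite !inE => /eqP ->.
have nl u : u \in S -> ~~ looped G u by move=> uS; have:= noloop u; rewrite uS.
have [/existsP[u /existsP[v /and3P[uS vS uv]]]|noedge] :=
    boolP [exists u, exists v, [&& u \in S, v \in S & adj G u v]].
  have neq_uv : u != v by apply: contraTneq uv => <-; apply: nl.
  exists (Pivot u v); split=> /=; first by rewrite neq_uv uv !nl.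
    by rewrite inE neq_uv.
  by apply/subsetP=> y; rewrite !inE => /orP[]/eqP ->.
have aS u v : u \in S -> v \in S -> adj G u v = false.
  move=> uS vS; apply: contraNF noedge => uv.
  by apply/existsP; exists u; apply/existsP; exists v; rewrite uS vS.
(* With neither loops nor edges inside [S], the indicator of [x] is a nonzero vector supported in
   [S] whose image vanishes on [S]. *)
have := NS (pred1 x) (apply_adj G (pred1 x)) (fun _ => erefl).
move=> /(_ _ x); rewrite {2}/swap xS /= eqxx => contra.
suff /contra : swap S (pred1 x) (apply_adj G (pred1 x)) =1 xpred0 by [].
move=> i; rewrite /swap apply_adj_pred1.
by case: ifPn => [iS|] /=; [apply: aS | apply: contraNF => /eqP->].
Qed.

Lemma nonsing_reduced G S : nonsing G S ->
  exists phi, [/\ applicable G phi, op_support phi = S & reduced phi].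
Proof.
(* Keeping all vertices of [phi] inside [S] makes the induction give reducedness: the tail then
   lives in [S :\: T] and avoids the vertices of the first operation. *)
suff: nonsing G S -> exists phi, [/\ applicable G phi, op_support phi = S,
    reduced phi & {subset flatten (map (@op_vertices V) phi) <= S}].
  by move=> ex /ex[phi [? ? ? _]]; exists phi.
have [n ltSn] := ubnP #|S|; elim: n => // n IH in G S ltSn * => NS.
have [->|S0] := eqVneq S set0.
  by exists [::]; split=> //; rewrite /op_support big_nil.
have [o [Go uo sub_oS]] := nonsing_ex_op NS S0.
set T := [set:: op_vertices o] in sub_oS.
have defS : symdiff T (S :\: T) = S.
  apply/setP=> y; rewrite in_symdiff in_setD; have /subsetP/(_ y) := sub_oS.
  by case: (y \in T) => [/(_ isT) ->|].
have ltST : #|S :\: T| < n.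
  apply: leq_trans (proper_card _) ltSn; rewrite properE subsetDl.
  have [y yo] : exists y, y \in op_vertices o.
    by case: (o) => [u|u v]; exists u; rewrite inE eqxx.
  apply/subsetPn; exists y; last by rewrite !inE yo.
  by apply: (subsetP sub_oS); rewrite inE.
have NST : nonsing (op_apply G o) (S :\: T).
  by apply: nonsing_op => //; rewrite -/T defS.
have [phi [Gphi supphi redphi subphi]] := IH _ _ ltST NST.
exists (o :: phi); split=> /=; first by rewrite Go.
- by rewrite op_support_cons supphi.
- rewrite /reduced /= cat_uniq uo [uniq _]redphi andbT /=.
  by apply/hasPn=> y /subphi; rewrite !inE => /andP[].
- move=> y; rewrite mem_cat => /orP[yo|/subphi].
    by apply: (subsetP sub_oS); rewrite inE.
  by rewrite inE => /andP[].
Qed.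

End Lagrangian.

(** * From boolean vectors to determinants over GF(2) *)

Local Open Scope ring_scope.

Lemma F2_eq0 (a : 'F_2) : a = (a != 0)%:R.
Proof. by case: a => -[|[]] // lt; apply/val_inj. Qed.

Lemma F2_natr_inj : injective (fun b : bool => b%:R : 'F_2).
Proof. by do 2!case. Qed.

Lemma F2_natr_sum (I : finType) (P : pred I) (F : I -> bool) :
  (\big[addb/false]_(i | P i) F i)%:R = \sum_(i | P i) (F i)%:R :> 'F_2.
Proof.
by apply: (big_morph (fun b : bool => b%:R : 'F_2)) => // -[] [] //; apply/val_inj.
Qed.

Lemma gdet_eq1 (T : finType) (H : lgraph T) :
  gdet H = 1 <->
  forall w : T -> bool, apply_adj H w =1 xpred0 -> w =1 xpred0.
Proof.
apply: (@iff_trans _ (gdet H != 0)).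
  by rewrite [gdet H]F2_eq0; case: (gdet H != 0).
split=> [/det0P det_n0 w Aw0 x | ker0].
  apply/negP=> wx; apply: det_n0.
  exists (\row_j (w (enum_val j))%:R).
    apply/eqP=> /rowP/(_ (enum_rank x)); rewrite !mxE enum_rankK wx.
    by move/eqP; rewrite oner_eq0.
  apply/rowP=> j; rewrite !mxE -[RHS]/(false%:R) -(Aw0 (enum_val j)).
  rewrite /apply_adj F2_natr_sum (reindex _ (onW_bij _ (enum_val_bij T))).
  by apply: eq_bigr => i _; rewrite !mxE -natrM mulnb andbC adj_sym.
(* [det0P] yields a left kernel vector; symmetry of the adjacency matrix makes it a right one. *)
apply/det0P=> -[v vn0 vA0]; case/negP: vn0; apply/eqP/rowP=> j.
pose w x := v 0 (enum_rank x) != 0.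
rewrite mxE [LHS]F2_eq0; suff ->: v 0 j != 0 = false by [].
rewrite -[j]enum_valK; apply: (ker0 w) => x; apply: F2_natr_inj.
rewrite /apply_adj F2_natr_sum (reindex _ (onW_bij _ (enum_val_bij T))) /=.
move/rowP/(_ (enum_rank x)): vA0; rewrite !mxE => vAx; rewrite -[RHS]vAx.
apply: eq_bigr => i _; rewrite !mxE enum_rankK /w enum_valK.
rewrite [in RHS](F2_eq0 (v 0 i)) -natrM mulnb andbC.
by rewrite adj_sym.
Qed.

(** The premise [swap S w z =1 xpred0] says that [w] is supported in [S] and [z] vanishes on [S], so
    [w] restricts to a kernel vector of the induced graph. Conversely, a kernel vector there is
    extended by zero. *)
Lemma gdet_induced (V : finType) (G : lgraph V) (S : {set V}) :
  gdet (induced G S) = 1 <-> nonsing G S.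
Proof.
pose sT := {x : V | x \in S}.
have restr (w : V -> bool) (x : sT) : (forall i, i \notin S -> w i = false) ->
    apply_adj (induced G S) (w \o val) x = apply_adj G w (val x).
  move=> w0; rewrite /apply_adj [RHS](bigID (mem S)) /= [X in _ (+) X]big1.
    rewrite addbF [RHS](reindex_omap (val : sT -> V) insub).
      by apply: eq_big => i; rewrite ?adj_mk_lgraph // (valP i) valK eqxx.
    by move=> i iS; rewrite insubT.
  by move=> i /w0 ->; rewrite andbF.
apply: iff_trans (gdet_eq1 _) _; split=> [ker0 w z Lwz w0 i|NS w Aw0 x].
  have wS j : j \notin S -> w j = false.
    by move=> /negPf jS; have:= w0 j; rewrite /swap jS.
  have wv : w \o val =1 xpred0 :> (sT -> bool).
    apply: ker0 => x; rewrite restr // -Lwz; have:= w0 (val x).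
    by rewrite /swap (valP x).
  have {}w0 j : w j = false.
    by case: (boolP (j \in S)) => [jS|/wS//]; exact: (wv (Sub j jS)).
  rewrite /swap w0 Lwz /apply_adj big1 ?if_same // => j _.
  by rewrite w0 andbF.
pose w' (i : V) := if insub i is Some y then w y else false.
have wE : w' \o val =1 w by move=> y; rewrite /w' /= valK.
have wS i : i \notin S -> w' i = false by move=> iS; rewrite /w' insubN.
have := NS w' (apply_adj G w') (fun _ => erefl) _ (val x).
rewrite {2}/swap (valP x) -wE; apply=> i; rewrite /swap.
case: ifPn => [iS|/wS//]; rewrite -[i]/(val (Sub i iS : sT)) -restr //.
by rewrite (eq_apply_adj _ wE) Aw0.
Qed.

Local Close Scope ring_scope.

Theorem theorem8 (V : finType) (G : lgraph V) :
  (forall phi phi' : seq (operation V),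
     applicable G phi -> applicable G phi' -> op_support phi = op_support phi' ->
     seq_apply G phi = seq_apply G phi') /\
  (forall S : {set V},
     (gdet (induced G S) = 1%R <->
      exists phi : seq (operation V), applicable G phi /\ op_support phi = S) /\
     (gdet (induced G S) = 1%R ->
      exists phi : seq (operation V),
        [/\ applicable G phi, op_support phi = S & reduced phi])).
Proof.
split=> [phi phi'|S]; first exact: seq_apply_support.
have red : gdet (induced G S) = 1%R -> exists phi,
    [/\ applicable G phi, op_support phi = S & reduced phi].
  by move/gdet_induced/nonsing_reduced.
split=> //; split=> [/red[phi [? ? _]]|[phi [Gphi <-]]]; first by exists phi.
exact/gdet_induced/nonsing_applicable.
Qed.
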